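(* In $\mathsf P$, $\mathsf{GHS}$ implies $\mathsf{NPC}$.
   Context: Framework. $\mathsf{E\text{-}PA}^{\omega*}$ is Peano arithmetic in all finite types with the axiom of extensionality, with additional types $\rho^*$ of finite sequences; type $0$ = naturals, $1=0\to0$, $2=1\to0$, $3=2\to0$. The language of $\mathsf P$ adds a predicate $\mathrm{st}$ (''standard'') for every type; $(\forall^{\mathrm{st}}x)\varphi\equiv(\forall x)(\mathrm{st}(x)\to\varphi)$, $(\exists^{\mathrm{st}}x)\varphi\equiv(\exists x)(\mathrm{st}(x)\wedge\varphi)$; internal = not containing $\mathrm{st}$. $\mathsf P$ is $\mathsf{E\text{-}PA}^{\omega*}$ plus: (i) $\mathrm{st}(x)\wedge x=y\to\mathrm{st}(y)$; (ii) $\mathrm{st}(t)$ for each closed term $t$; (iii) $\mathrm{st}(f)\wedge\mathrm{st}(x)\to\mathrm{st}(f(x))$; (iv) external induction for every formula; (v) $\mathsf{HAC}_{\mathrm{int}}$: for internal $\varphi$, $(\forall^{\mathrm{st}}x^\rho)(\exists^{\mathrm{st}}y^\tau)\varphi(x,y)\to(\exists^{\mathrm{st}}F^{\rho\to\tau^*})(\forall^{\mathrm{st}}x^\rho)(\exists y\in F(x))\varphi(x,y)$; (vi) idealisation: for internal $\varphi$ with arbitrary parameters, $(\forall^{\mathrm{st}}x^{\sigma^*})(\exists y^\tau)(\forall z^\sigma\in x)\varphi(z,y)\to(\exists y^\tau)(\forall^{\mathrm{st}}x^\sigma)\varphi(x,y)$. $N\in\Omega$ means $\neg\mathrm{st}(N^0)$;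 $f\approx_1g$ means $(\forall^{\mathrm{st}}n)f(n)=g(n)$. Finite sequences of numbers coded by numbers; $|s|$ length, $*$ concatenation, $\overline sM,\overline\alpha M$ initial segments of length $M$, $s*00\dots$ = $s$ followed by zeros. $Y^2\in C$ means $(\forall f)(\exists N)(\forall g)(\overline gN=\overline fN\to Y(f)=Y(g))$. $\mathsf{NPC}$: $(\forall^{\mathrm{st}}Y^2\in C,f^1)(\forall g^1)(f\approx_1g\to Y(f)=_0Y(g))$. $H(Y,s,M)=Y(\overline sM*00\dots)$ if $|s|\ge M$, else $Y(s*0*H(Y,s*1,M)*\dots*H(Y,s*M,M)*00\dots)$. $\mathsf{GH}_{\mathrm{st}}(\Gamma)$: $(\forall^{\mathrm{st}}Y^2\in C,s^0)[\Gamma(Y,s)=Y(s*0*(\lambda n)\Gamma(Y,s*(n+1)))]$. $\mathsf{GHS}$: there is a standard $\Gamma^3$ such that $\mathsf{GH}_{\mathrm{st}}(\Gamma)$ and $(\forall^{\mathrm{st}}Y^2\in C,\alpha^1)(\forall N^0,M^0\in\Omega)(\forall s^0)\big(\overline\alpha M=_0\overline{s*00\dots}M\to\Gamma(Y,s)=_0H(Y,s,N)\big)$. *)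

(* Defs.v *)
From Stdlib Require Import List.
Import ListNotations.

(** * Finite types *)

Inductive ty : Type :=
| Nat : ty
| Arr : ty -> ty -> ty
| Seq : ty -> ty.

Declare Scope ty_scope.
Delimit Scope ty_scope with ty.
Bind Scope ty_scope with ty.
Notation "0" := Nat : ty_scope.
Notation "a ⇒ b" := (Arr a b) (at level 60, right associativity) : ty_scope.
Notation "a ^*" := (Seq a) (at level 9, format "a ^*") : ty_scope.
Notation "1" := (Arr Nat Nat) : ty_scope.
Notation "2" := (Arr (Arr Nat Nat) Nat) : ty_scope.

(** * Terms and formulas

    Well-typed de Bruijn syntax: [tm G t] is the type of terms of type [t]
    whose free variables are declared in [G]; the head of [G] is the most
    recently bound variable. *)

Definition ctx := list ty.

Inductive var (t : ty) : ctx -> Type :=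
| vz G : var t (t :: G)
| vs u G : var t G -> var t (u :: G).
Arguments vz {t G}.
Arguments vs {t u G} _.

(* Primitive lambda abstraction stands for the combinators [k] and [s]. *)
Inductive tm (G : ctx) : ty -> Type :=
| Var t : var t G -> tm G t
| Lam t u : tm (t :: G) u -> tm G (t ⇒ u)
| App t u : tm G (t ⇒ u) -> tm G t -> tm G u
| Zero : tm G 0
| Succ : tm G (0 ⇒ 0)
| Rec t : tm G (t ⇒ (0 ⇒ t ⇒ t) ⇒ 0 ⇒ t)
| Nil t : tm G (t^*)
| Cons t : tm G (t ⇒ t^* ⇒ t^*)
| LRec t u : tm G (u ⇒ (t ⇒ t^* ⇒ u ⇒ u) ⇒ t^* ⇒ u).
Arguments Var {G t} _.
Arguments Lam {G t u} _.
Arguments App {G t u} _ _.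
Arguments Zero {G}.
Arguments Succ {G}.
Arguments Rec {G t}.
Arguments Nil {G t}.
Arguments Cons {G t}.
Arguments LRec {G t u}.

Inductive fm (G : ctx) : Type :=
| Bot : fm G
| Eq t : tm G t -> tm G t -> fm G
| St t : tm G t -> fm G
| Imp : fm G -> fm G -> fm G
| All t : fm (t :: G) -> fm G.
Arguments Bot {G}.
Arguments Eq {G t} _ _.
Arguments St {G t} _.
Arguments Imp {G} _ _.
Arguments All {G t} _.

Fixpoint internal {G} (p : fm G) : Prop :=
  match p with
  | Bot => True
  | Eq _ _ => True
  | St _ => False
  | Imp p q => internal p /\ internal q
  | All p => internal p
  end.

(** ** Renaming and substitution *)

Definition renaming (G D : ctx) := forall t, var t G -> var t D.
Definition substitution (G D : ctx) := forall t, var t G -> tm D t.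

Definition var_case {u G} (P : forall t, var t (u :: G) -> Type)
    (hz : P u vz) (hs : forall t (v : var t G), P t (vs v)) :
    forall t (v : var t (u :: G)), P t v :=
  fun t v =>
    match v in var _ K return
      match K return var t K -> Type with
      | [] => fun _ => unit
      | u' :: G' => fun v => forall P : forall t, var t (u' :: G') -> Type,
          P u' vz -> (forall t (v : var t G'), P t (vs v)) -> P t v
      end v
    with
    | vz => fun P hz hs => hz
    | vs v => fun P hz hs => hs t v
    end P hz hs.

Definition up_ren {G D} (u : ty) (r : renaming G D) :
    renaming (u :: G) (u :: D) :=
  var_case (fun t _ => var t (u :: D)) vz (fun t v => vs (r t v)).

Fixpoint ren_tm {G D t} (r : renaming G D) (a : tm G t) : tm D t :=
  match a in tm _ t return tm D t with
  | Var v => Var (r _ v)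
  | @Lam _ u _ b => Lam (ren_tm (up_ren u r) b)
  | App f b => App (ren_tm r f) (ren_tm r b)
  | Zero => Zero
  | Succ => Succ
  | Rec => Rec
  | Nil => Nil
  | Cons => Cons
  | LRec => LRec
  end.

Fixpoint ren_fm {G D} (r : renaming G D) (p : fm G) : fm D :=
  match p with
  | Bot => Bot
  | Eq a b => Eq (ren_tm r a) (ren_tm r b)
  | St a => St (ren_tm r a)
  | Imp p q => Imp (ren_fm r p) (ren_fm r q)
  | @All _ u p => All (ren_fm (up_ren u r) p)
  end.

Definition wk {G} (u : ty) : renaming G (u :: G) := fun _ v => vs v.

Definition closed_ren {G} : renaming [] G :=
  fun t v =>
    match v in var _ K return match K with [] => var t G | _ => unit end with
    | vz => tt
    | vs _ => tt
    end.

Definition scons {G D u} (a : tm D u) (s : substitution G D) :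
    substitution (u :: G) D :=
  var_case (fun t _ => tm D t) a s.

Definition up_sub {G D} (u : ty) (s : substitution G D) :
    substitution (u :: G) (u :: D) :=
  scons (Var vz) (fun t v => ren_tm (wk u) (s t v)).

Fixpoint sub_tm {G D t} (s : substitution G D) (a : tm G t) : tm D t :=
  match a in tm _ t return tm D t with
  | Var v => s _ v
  | @Lam _ u _ b => Lam (sub_tm (up_sub u s) b)
  | App f b => App (sub_tm s f) (sub_tm s b)
  | Zero => Zero
  | Succ => Succ
  | Rec => Rec
  | Nil => Nil
  | Cons => Cons
  | LRec => LRec
  end.

Fixpoint sub_fm {G D} (s : substitution G D) (p : fm G) : fm D :=
  match p with
  | Bot => Bot
  | Eq a b => Eq (sub_tm s a) (sub_tm s b)
  | St a => St (sub_tm s a)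
  | Imp p q => Imp (sub_fm s p) (sub_fm s q)
  | @All _ u p => All (sub_fm (up_sub u s) p)
  end.

(** ** Concrete syntax

    [Ext G D] is inferred when [D] is [G] with further variables bound on top
    of it; it supplies the weakening [⇑] from [G] to [D]. *)

Class Ext (G D : ctx) : Type := ext : renaming G D.
#[global] Instance ext_refl G : Ext G G | 0 := fun _ v => v.
#[global] Instance ext_cons G D u (e : Ext G D) : Ext G (u :: D) | 1 :=
  fun t v => vs (e t v).

Definition lift {G D t} {e : Ext G D} (a : tm G t) : tm D t := ren_tm e a.

(* [p] with its newest variable(s) replaced by [a] (and [b]), in a context [D]
   that extends the one of the remaining variables. *)
Definition inst_tm {G D t u} {e : Ext G D} (b : tm (t :: G) u) (a : tm D t) :
    tm D u :=
  sub_tm (scons a (fun _ v => Var (e _ v))) b.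
Definition inst {G D t} {e : Ext G D} (p : fm (t :: G)) (a : tm D t) : fm D :=
  sub_fm (scons a (fun _ v => Var (e _ v))) p.
Definition inst2 {G D t u} {e : Ext G D} (p : fm (t :: u :: G))
    (a : tm D t) (b : tm D u) : fm D :=
  sub_fm (scons a (scons b (fun _ v => Var (e _ v)))) p.

Definition fLam {G} t {u} (b : tm (t :: G) t -> tm (t :: G) u) : tm G (t ⇒ u) :=
  Lam (b (Var vz)).
Definition fAll {G} t (p : tm (t :: G) t -> fm (t :: G)) : fm G :=
  All (p (Var vz)).

Definition Not {G} (p : fm G) : fm G := Imp p Bot.
Definition And {G} (p q : fm G) : fm G := Not (Imp p (Not q)).
Definition Or {G} (p q : fm G) : fm G := Imp (Not p) q.
Definition fEx {G} t (p : tm (t :: G) t -> fm (t :: G)) : fm G :=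
  Not (fAll t (fun x => Not (p x))).
Definition fAllst {G} t (p : tm (t :: G) t -> fm (t :: G)) : fm G :=
  fAll t (fun x => Imp (St x) (p x)).
Definition fExst {G} t (p : tm (t :: G) t -> fm (t :: G)) : fm G :=
  fEx t (fun x => And (St x) (p x)).

Arguments fLam {G} t%_ty {u} & b.
Arguments fAll {G} t%_ty & p.
Arguments fEx {G} t%_ty & p.
Arguments fAllst {G} t%_ty & p.
Arguments fExst {G} t%_ty & p.

Declare Scope tm_scope.
Delimit Scope tm_scope with tm.
Bind Scope tm_scope with tm.
Declare Scope fm_scope.
Delimit Scope fm_scope with fm.
Bind Scope fm_scope with fm.

Notation "⇑ a" := (lift a) (at level 5, a at level 5, format "⇑ a").
Notation "f ∙ a" := (App f a) (at level 20, left associativity) : tm_scope.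
Notation "0" := Zero : tm_scope.
Notation "'λ' x : t , b" := (fLam t (fun x => b%tm))
  (at level 69, x name, t at level 61, b at level 69) : tm_scope.

Notation "a == b" := (Eq a%tm b%tm) (at level 70, no associativity) : fm_scope.
Notation "¬ p" := (Not p) (at level 75, right associativity) : fm_scope.
Notation "p ∧ q" := (And p q) (at level 80, right associativity) : fm_scope.
Notation "p ∨ q" := (Or p q) (at level 85, right associativity) : fm_scope.
Notation "p → q" := (Imp p q) (at level 99, q at level 200,
  right associativity) : fm_scope.
Notation "∀ x : t , p" := (fAll t (fun x => p%fm))
  (at level 200, x name, t at level 61, p at level 200) : fm_scope.
Notation "∃ x : t , p" := (fEx t (fun x => p%fm))
  (at level 200, x name, t at level 61, p at level 200) : fm_scope.
Notation "∀st x : t , p" := (fAllst t (fun x => p%fm))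
  (at level 200, x name, t at level 61, p at level 200) : fm_scope.
Notation "∃st x : t , p" := (fExst t (fun x => p%fm))
  (at level 200, x name, t at level 61, p at level 200) : fm_scope.

(** * Arithmetic and sequences in the language *)

Section Terms.
Local Open Scope tm_scope.

Definition add {G} : tm G (0 ⇒ 0 ⇒ 0) :=
  λ m : 0, λ n : 0, Rec ∙ ⇑m ∙ (λ k : 0, λ r : 0, Succ ∙ r) ∙ n.
Definition prd {G} : tm G (0 ⇒ 0) :=
  Rec ∙ 0 ∙ (λ k : 0, λ r : 0, ⇑k).
(* truncated subtraction *)
Definition monus {G} : tm G (0 ⇒ 0 ⇒ 0) :=
  λ m : 0, λ n : 0, Rec ∙ ⇑m ∙ (λ k : 0, λ r : 0, prd ∙ r) ∙ n.

Fixpoint default {G} (t : ty) : tm G t :=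
  match t with
  | Nat => Zero
  | Arr t u => Lam (default u)
  | Seq t => Nil
  end.

Definition len {G t} : tm G (t^* ⇒ 0) :=
  LRec ∙ 0 ∙ (λ a : t, λ l : t^*, λ r : 0, Succ ∙ r).
(* [entry ∙ l ∙ i] is [default t] when [i] is not an index of [l] *)
Definition entry {G t} : tm G (t^* ⇒ 0 ⇒ t) :=
  LRec ∙ default (0 ⇒ t)
       ∙ (λ a : t, λ l : t^*, λ r : 0 ⇒ t,
            Rec ∙ ⇑a ∙ (λ j : 0, λ q : t, ⇑r ∙ ⇑j)).
Definition snoc {G t} : tm G (t^* ⇒ t ⇒ t^*) :=
  λ l : t^*, λ b : t,
    LRec ∙ (Cons ∙ b ∙ Nil)
         ∙ (λ a : t, λ l : t^*, λ r : t^*, Cons ∙ ⇑a ∙ r) ∙ ⇑l.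
(* the first [n] entries of [l] *)
Definition take {G t} : tm G (t^* ⇒ 0 ⇒ t^*) :=
  LRec ∙ (λ n : 0, Nil)
       ∙ (λ a : t, λ l : t^*, λ r : 0 ⇒ t^*,
            Rec ∙ Nil ∙ (λ j : 0, λ q : t^*, Cons ∙ ⇑a ∙ (⇑r ∙ ⇑j))).
(* <f(0), ..., f(n-1)> *)
Definition seg {G t} : tm G (0 ⇒ (0 ⇒ t) ⇒ t^*) :=
  Rec ∙ (λ f : 0 ⇒ t, Nil)
      ∙ (λ n : 0, λ r : (0 ⇒ t) ⇒ t^*, λ f : 0 ⇒ t,
           Cons ∙ (f ∙ 0) ∙ (⇑r ∙ (λ k : 0, ⇑f ∙ (Succ ∙ k)))).
(* the finite sequence [l] followed by the values of [f] *)
Definition cat {G t} : tm G (t^* ⇒ (0 ⇒ t) ⇒ 0 ⇒ t) :=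
  λ l : t^*, λ f : 0 ⇒ t,
    LRec ∙ f
         ∙ (λ a : t, λ l : t^*, λ r : 0 ⇒ t,
              Rec ∙ ⇑a ∙ (λ j : 0, λ q : t, ⇑r ∙ ⇑j)) ∙ ⇑l.

(** ** Coding of finite sequences of numbers by numbers

    The coding is the bijection given by code <> = 0 and
    code (<a> * l) = 2^a (2 code l + 1).  Its inverse [dec] is computed by
    iterating [next], which satisfies code (next l) = code l + 1. *)

Definition code {G} : tm G (0^* ⇒ 0) :=
  LRec ∙ 0
       ∙ (λ a : 0, λ l : 0^*, λ r : 0,
            Rec ∙ (Succ ∙ (add ∙ r ∙ r)) ∙ (λ k : 0, λ q : 0, add ∙ q ∙ q) ∙ ⇑a).

(* adds 1 to the head: doubles a non-zero code *)
Definition shift {G} : tm G (0^* ⇒ 0^*) :=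
  LRec ∙ Nil ∙ (λ a : 0, λ l : 0^*, λ r : 0^*, Cons ∙ (Succ ∙ ⇑a) ∙ ⇑l).
(* next <> = <0>, next (<0> * l) = shift (next l),
   next (<a+1> * l) = <0, a> * l *)
Definition next {G} : tm G (0^* ⇒ 0^*) :=
  LRec ∙ (Cons ∙ 0 ∙ Nil)
       ∙ (λ a : 0, λ l : 0^*, λ r : 0^*,
            Rec ∙ (shift ∙ r)
                ∙ (λ b : 0, λ q : 0^*, Cons ∙ 0 ∙ (Cons ∙ ⇑b ∙ ⇑l)) ∙ ⇑a).
Definition dec {G} : tm G (0 ⇒ 0^*) :=
  Rec ∙ Nil ∙ (λ k : 0, λ r : 0^*, next ∙ r).

(* |s| *)
Definition lh {G} : tm G (0 ⇒ 0) := λ s : 0, len ∙ (dec ∙ s).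
(* s * <n> *)
Definition ext1 {G} : tm G (0 ⇒ 0 ⇒ 0) :=
  λ s : 0, λ n : 0, code ∙ (snoc ∙ (dec ∙ ⇑s) ∙ n).
(* s * f, for a finite [s] and an infinite [f] *)
Definition catf {G} : tm G (0 ⇒ 1 ⇒ 1) :=
  λ s : 0, cat ∙ (dec ∙ s).
(* 00... *)
Definition zeros {G} : tm G 1 := λ n : 0, 0.
(* s * 00... *)
Definition pad {G} : tm G (0 ⇒ 1) := λ s : 0, catf ∙ s ∙ zeros.
(* the initial segment of length M of a finite sequence [s], |s| >= M,
   and of an infinite one [f] *)
Definition initS {G} : tm G (0 ⇒ 0 ⇒ 0) :=
  λ s : 0, λ M : 0, code ∙ (take ∙ (dec ∙ ⇑s) ∙ M).
Definition initF {G} : tm G (1 ⇒ 0 ⇒ 0) :=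
  λ f : 1, λ M : 0, code ∙ (seg ∙ M ∙ ⇑f).
(* <0> * f *)
Definition zcons {G} : tm G (1 ⇒ 1) :=
  cat ∙ (Cons ∙ 0 ∙ Nil).

(** ** The functional H

    [Hrec ∙ Y ∙ M ∙ k ∙ s] unfolds the recursion for [H(Y,s,M)] to depth [k].
    The depth needed is [M - |s|], which is 0 exactly when [|s| >= M] and which
    drops by one from [s] to [s * n]. *)

Definition Hrec {G} : tm G (2 ⇒ 0 ⇒ 0 ⇒ 0 ⇒ 0) :=
  λ Y : 2, λ M : 0,
    Rec ∙ (λ s : 0, ⇑Y ∙ (pad ∙ (initS ∙ s ∙ ⇑M)))
        ∙ (λ k : 0, λ h : 0 ⇒ 0, λ s : 0,
             ⇑Y ∙ (catf ∙ s ∙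
               (zcons ∙ (cat ∙ (seg ∙ ⇑M ∙ (λ n : 0, ⇑h ∙ (ext1 ∙ ⇑s ∙ (Succ ∙ n))))
                             ∙ zeros)))).
Definition Hfun {G} : tm G (2 ⇒ 0 ⇒ 0 ⇒ 0) :=
  λ Y : 2, λ s : 0, λ M : 0,
    Hrec ∙ ⇑Y ∙ M ∙ (monus ∙ M ∙ (lh ∙ ⇑s)) ∙ ⇑s.

End Terms.

Section Formulas.
Local Open Scope fm_scope.

Definition Lt {G} (m n : tm G 0) : fm G :=
  ∃ k : 0, Succ ∙ (add ∙ ⇑m ∙ k) == ⇑n.

(* membership in a finite sequence *)
Definition Mem {G t} (y : tm G t) (l : tm G (t^*)) : fm G :=
  ∃ i : 0, Lt i (len ∙ ⇑l)%tm ∧ entry ∙ ⇑l ∙ i == ⇑y.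

(** * The system P *)

(** Axioms of E-PA^ω*.  Equality is primitive at every type; extensionality is
    then the statement that functions with equal values are equal.  Congruence
    of equality is [ax_leibniz], which, like induction, is restricted to
    internal formulas. *)
Inductive axEPA {G} : fm G -> Prop :=
| ax_refl t (a : tm G t) : axEPA (a == a)
| ax_leibniz t (a b : tm G t) (p : fm (t :: G)) : internal p ->
    axEPA (a == b → inst p a → inst p b)
| ax_extensionality t u (f g : tm G (t ⇒ u)) :
    axEPA ((∀ x : t, ⇑f ∙ x == ⇑g ∙ x) → f == g)
| ax_beta t u (b : tm (t :: G) u) (a : tm G t) :
    axEPA (Lam b ∙ a == inst_tm b a)
| ax_succ_inj (a b : tm G 0) :
    axEPA (Succ ∙ a == Succ ∙ b → a == b)
| ax_succ_nonzero (a : tm G 0) : axEPA (¬ Succ ∙ a == 0)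
| ax_rec_zero t (a : tm G t) f : axEPA (Rec ∙ a ∙ f ∙ 0 == a)
| ax_rec_succ t (a : tm G t) f n :
    axEPA (Rec ∙ a ∙ f ∙ (Succ ∙ n) == f ∙ n ∙ (Rec ∙ a ∙ f ∙ n))
| ax_lrec_nil t u (a : tm G u) (f : tm G (t ⇒ t^* ⇒ u ⇒ u)) :
    axEPA (LRec ∙ a ∙ f ∙ Nil == a)
| ax_lrec_cons t u (a : tm G u) (f : tm G (t ⇒ t^* ⇒ u ⇒ u)) b l :
    axEPA (LRec ∙ a ∙ f ∙ (Cons ∙ b ∙ l) == f ∙ b ∙ l ∙ (LRec ∙ a ∙ f ∙ l))
| ax_seq t (l : tm G (t^*)) :
    axEPA (l == Nil ∨ ∃ a : t, ∃ k : t^*, ⇑l == Cons ∙ ⇑a ∙ k)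
| ax_induction (p : fm (Nat :: G)) : internal p ->
    axEPA (inst p 0%tm → (∀ n : 0, inst p n → inst p (Succ ∙ n)%tm) →
           ∀ n : 0, inst p n).

(** In [ax_HAC_int] and [ax_idealisation] the variables of [p] other than its
    two newest ones are parameters, standard or not. *)
Inductive axP {G} : fm G -> Prop :=
| ax_EPA p : axEPA p -> axP p
| ax_st_eq t (a b : tm G t) : axP (St a ∧ a == b → St b)
| ax_st_closed t (a : tm [] t) : axP (St (ren_tm closed_ren a))
| ax_st_app t u (f : tm G (t ⇒ u)) (a : tm G t) :
    axP (St f ∧ St a → St (f ∙ a)%tm)
| ax_external_induction (p : fm (Nat :: G)) :
    axP (inst p 0%tm → (∀st n : 0, inst p n → inst p (Succ ∙ n)%tm) →
         ∀st n : 0, inst p n)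
| ax_HAC_int r t (p : fm (t :: r :: G)) : internal p ->
    axP ((∀st x : r, ∃st y : t, inst2 p y ⇑x) →
         ∃st F : r ⇒ t^*, ∀st x : r, ∃ y : t,
           Mem y (⇑F ∙ ⇑x)%tm ∧ inst2 p y ⇑x)
| ax_idealisation s t (p : fm (t :: s :: G)) : internal p ->
    axP ((∀st x : s^*, ∃ y : t, ∀ z : s, Mem z ⇑x → inst2 p ⇑y z) →
         ∃ y : t, ∀st x : s, inst2 p ⇑y x).

(** Classical natural deduction from the axioms of P, over the free variables
    [G] and the hypotheses [hs]. *)
Inductive prv : forall G, list (fm G) -> fm G -> Prop :=
| prv_ax G hs p : axP p -> prv G hs p
| prv_hyp G hs p : List.In p hs -> prv G hs p
| prv_impI G hs p q : prv G (p :: hs) q -> prv G hs (p → q)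
| prv_impE G hs p q : prv G hs (p → q) -> prv G hs p -> prv G hs q
| prv_raa G hs p : prv G ((¬ p) :: hs) Bot -> prv G hs p
| prv_allI G hs t (p : fm (t :: G)) :
    prv (t :: G) (map (ren_fm (wk t)) hs) p -> prv G hs (All p)
| prv_allE G hs t (p : fm (t :: G)) (a : tm G t) :
    prv G hs (All p) -> prv G hs (inst p a).

Definition provable_in_P (p : fm []) : Prop := prv [] [] p.

(** * The principles *)

Definition Omega {G} (N : tm G 0) : fm G := ¬ St N.

Definition approx1 {G} (f g : tm G 1) : fm G :=
  ∀st n : 0, ⇑f ∙ n == ⇑g ∙ n.

(* Y ∈ C *)
Definition inC {G} (Y : tm G 2) : fm G :=
  ∀ f : 1, ∃ N : 0, ∀ g : 1,
    initF ∙ g ∙ ⇑N == initF ∙ ⇑f ∙ ⇑N → ⇑Y ∙ ⇑f == ⇑Y ∙ g.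

Definition NPC : fm [] :=
  ∀st Y : 2, inC Y → ∀st f : 1, ∀ g : 1,
    approx1 ⇑f g → ⇑Y ∙ ⇑f == ⇑Y ∙ g.

(* A type-3 functional of the pair (Y,s), curried: 2 ⇒ 0 ⇒ 0. *)
Definition GHst {G} (Gam : tm G (2 ⇒ 0 ⇒ 0)) : fm G :=
  ∀st Y : 2, inC Y → ∀st s : 0,
    ⇑Gam ∙ ⇑Y ∙ s ==
    ⇑Y ∙ (catf ∙ s ∙ (zcons ∙ (λ n : 0, ⇑Gam ∙ ⇑Y ∙ (ext1 ∙ ⇑s ∙ (Succ ∙ n))))).

Definition GHS : fm [] :=
  ∃st Gam : 2 ⇒ 0 ⇒ 0,
    GHst Gam ∧
    ∀st Y : 2, inC Y → ∀st alpha : 1, ∀ N : 0, ∀ M : 0,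
      Omega ⇑N → Omega M → ∀ s : 0,
        initF ∙ ⇑alpha ∙ ⇑M == initF ∙ (pad ∙ s) ∙ ⇑M →
        ⇑Gam ∙ ⇑Y ∙ s == Hfun ∙ ⇑Y ∙ s ∙ ⇑N.

End Formulas.

(* Main.v *)
From Stdlib Require Import List FunctionalExtensionality Setoid Morphisms.
Require Import Defs.
Import ListNotations.

(** Let [M] be nonstandard with [f] and [h] agreeing below [M], let [N] be a
    modulus of continuity of [Y] at [h], and let [s] code the first [N + M]
    values of [h].  As [s * 00...] agrees with the standard [f] up to [M], GHS
    gives [H(Y,s,M) = Gam(Y,s) = H(Y,s,N+M)]; since [|s| = N + M], both sides
    are instances of the base clause of [H], and the equation reads
    [Y(h|M * 00...) = Y(h|(N+M) * 00...) = Y(h)].  Taking [h := f] and [h := g]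
    gives [Y(f) = Y(g)] as soon as [f] and [g] agree below some nonstandard
    number.  To see that they do, suppose [Y(f) <> Y(g)] and show by internal
    induction that [f] and [g] agree below every [n]: the step from a standard
    [n] is [f ≈ g], and a nonstandard [n] is already contradictory.  Then [f]
    and [g] agree below a modulus of [Y] at [f], a contradiction. *)

(** * Renaming and substitution *)

(** A variable of [u :: G] is [vz] or some [vs v]. Function extensionality makes this an equation
    between substitutions, which can then be rewritten inside [sub_tm]. *)
Lemma var_case_eta {u G} {F : ty -> Type} (h : forall t, var t (u :: G) -> F t) :
  var_case (fun t _ => F t) (h u vz) (fun t v => h t (vs v)) = h.
Proof.
  extensionality t. extensionality v.
  apply (var_case (fun t v =>
    var_case (fun t _ => F t) (h u vz) (fun t v => h t (vs v)) t v = h t v)); reflexivity.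
Qed.

Lemma up_sub_var {G} u : up_sub u (fun t (v : var t G) => Var v) = fun t v => Var v.
Proof. exact (var_case_eta (fun t v => Var v)). Qed.

Lemma up_sub_ren {G D E} u (r : renaming G D) (s : substitution D E) :
  (fun t v => up_sub u s t (up_ren u r t v)) = up_sub u (fun t v => s t (r t v)).
Proof.
  symmetry. exact (var_case_eta (fun t v => up_sub u s t (up_ren u r t v))).
Qed.

Lemma up_sub_var_ren {G D} u (r : renaming G D) :
  up_sub u (fun t v => Var (r t v)) = fun t v => Var (up_ren u r t v).
Proof. exact (var_case_eta (fun t v => Var (up_ren u r t v))). Qed.

Lemma ren_as_sub {G D t} (r : renaming G D) (a : tm G t) :
  ren_tm r a = sub_tm (fun t v => Var (r t v)) a.
Proof.
  revert D r. induction a; intros D r; cbn; [reflexivity|..];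
    repeat match goal with IH : _ |- _ => rewrite IH end;
    rewrite ?up_sub_var_ren; reflexivity.
Qed.

Lemma sub_ren {G D E t} (r : renaming G D) (s : substitution D E) (a : tm G t) :
  sub_tm s (ren_tm r a) = sub_tm (fun t v => s t (r t v)) a.
Proof.
  revert D E r s. induction a; intros D E r s; cbn; [reflexivity|..];
    repeat match goal with IH : _ |- _ => rewrite IH end;
    rewrite ?up_sub_ren; reflexivity.
Qed.

Lemma sub_tm_var {G t} (a : tm G t) : sub_tm (fun t v => Var v) a = a.
Proof. induction a; cbn; rewrite ?up_sub_var; congruence. Qed.

Lemma sub_fm_var {G} (p : fm G) : sub_fm (fun t v => Var v) p = p.
Proof. induction p; cbn; rewrite ?up_sub_var, ?sub_tm_var; congruence. Qed.

(** [ax_induction] speaks of [inst p n] for a bound [n]; this turns such instances back into [p]. *)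
Lemma inst_self {G t} (p : fm (t :: G)) :
  inst (e := ext_cons G G t (ext_refl G)) p (Var vz) = p.
Proof.
  transitivity (sub_fm (fun t v => Var v) p); [|apply sub_fm_var].
  unfold inst. f_equal. exact (var_case_eta (fun t v => Var v)).
Qed.

Lemma sub_wk {G D t u} (b : tm D u) (s : substitution G D) (a : tm G t) :
  sub_tm (scons b s) (ren_tm (wk u) a) = sub_tm s a.
Proof. exact (sub_ren (wk u) (scons b s) a). Qed.

Open Scope fm_scope.

(** * Provable equality as a congruence *)

(** Making provable equality a Rocq relation lets setoid rewriting carry out equational reasoning
    inside P. *)
Definition eqv {G} (hs : list (fm G)) {t} (a b : tm G t) : Prop := prv G hs (a == b).

Lemma prv_leibniz {G hs t} {a b : tm G t} (p : fm (t :: G)) : internal p ->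
  eqv hs a b -> prv G hs (inst p a) -> prv G hs (inst p b).
Proof.
  intros Hp Hab Ha. refine (prv_impE _ _ _ _ (prv_impE _ _ _ _ _ Hab) Ha).
  apply prv_ax, ax_EPA, ax_leibniz, Hp.
Qed.

(** Leibniz with the motive [x == a] gives symmetry, and with [a == x] transitivity. *)
#[global] Instance eqv_equiv {G} (hs : list (fm G)) t : Equivalence (@eqv G hs t).
Proof.
  assert (R : forall a, @eqv G hs t a a) by (intro a; apply prv_ax, ax_EPA, ax_refl).
  assert (S : forall a b, @eqv G hs t a b -> eqv hs b a).
  { intros a b H.
    pose proof (prv_leibniz (Var vz == ren_tm (wk t) a) I H) as K.
    unfold inst in K. cbn in K. rewrite !sub_wk, sub_tm_var in K. apply K, R. }
  split; [exact R | exact S |].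
  intros a b c H1 H2.
  pose proof (prv_leibniz (ren_tm (wk t) a == Var vz) I H2) as K.
  unfold inst in K. cbn in K. rewrite !sub_wk, sub_tm_var in K. apply K, H1.
Qed.

(** Leibniz is applied to the argument, then to the function. Rewriting thus acts below
    applications; equations under a [λ] go through [eqv_ext]. *)
#[global] Instance App_proper {G} (hs : list (fm G)) t u :
  Proper (eqv hs ==> eqv hs ==> eqv hs) (@App G t u).
Proof.
  intros f g Hf a b Ha. transitivity (App f b).
  - pose proof (prv_leibniz (App (ren_tm (wk _) f) (ren_tm (wk t) a)
      == App (ren_tm (wk _) f) (Var vz)) I Ha) as K.
    unfold inst in K. cbn in K. rewrite !sub_wk, !sub_tm_var in K. apply K.
    change (eqv hs (App f a) (App f a)). reflexivity.
  - pose proof (prv_leibniz (App (ren_tm (wk (t ⇒ u)) f) (ren_tm (wk _) b)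
      == App (Var vz) (ren_tm (wk _) b)) I Hf) as K.
    unfold inst in K. cbn in K. rewrite !sub_wk, !sub_tm_var in K. apply K.
    change (eqv hs (App f b) (App f b)). reflexivity.
Qed.

Lemma beta {G} (hs : list (fm G)) t u (b : tm (t :: G) u) (a : tm G t) :
  eqv hs (Lam b ∙ a) (inst_tm b a).
Proof. apply prv_ax, ax_EPA, ax_beta. Qed.
Lemma rec_zero {G} (hs : list (fm G)) t (a : tm G t) f : eqv hs (Rec ∙ a ∙ f ∙ 0) a.
Proof. apply prv_ax, ax_EPA, ax_rec_zero. Qed.
Lemma rec_succ {G} (hs : list (fm G)) t (a : tm G t) f n :
  eqv hs (Rec ∙ a ∙ f ∙ (Succ ∙ n)) (f ∙ n ∙ (Rec ∙ a ∙ f ∙ n)).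
Proof. apply prv_ax, ax_EPA, ax_rec_succ. Qed.
Lemma lrec_nil {G} (hs : list (fm G)) t u (a : tm G u) (f : tm G (t ⇒ t^* ⇒ u ⇒ u)) :
  eqv hs (LRec ∙ a ∙ f ∙ Nil) a.
Proof. apply prv_ax, ax_EPA, ax_lrec_nil. Qed.
Lemma lrec_cons {G} (hs : list (fm G)) t u (a : tm G u) (f : tm G (t ⇒ t^* ⇒ u ⇒ u)) b l :
  eqv hs (LRec ∙ a ∙ f ∙ (Cons ∙ b ∙ l)) (f ∙ b ∙ l ∙ (LRec ∙ a ∙ f ∙ l)).
Proof. apply prv_ax, ax_EPA, ax_lrec_cons. Qed.

(** This is [sub_ren] in the form that [ren_as_sub] leaves behind, so that both can be rewrite rules
    of [sb]. *)
Lemma sub_sub_var {G D E t} (r : renaming G D) (s : substitution D E) (a : tm G t) :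
  sub_tm s (sub_tm (fun t v => Var (r t v)) a) = sub_tm (fun t v => s t (r t v)) a.
Proof. rewrite <- ren_as_sub. apply sub_ren. Qed.

(** * Closed terms under substitution *)

Section Closed.
Context {G D : ctx} (s : substitution G D).
(** As rewrite rules, these lemmas make a substitution vanish on a defined term while the term stays
    folded. *)
Lemma sub_add : sub_tm s add = add. Proof. reflexivity. Qed.
Lemma sub_prd : sub_tm s prd = prd. Proof. reflexivity. Qed.
Lemma sub_monus : sub_tm s monus = monus. Proof. reflexivity. Qed.
Lemma sub_len t : sub_tm s (@len G t) = len. Proof. reflexivity. Qed.
Lemma sub_snoc t : sub_tm s (@snoc G t) = snoc. Proof. reflexivity. Qed.
Lemma sub_take t : sub_tm s (@take G t) = take. Proof. reflexivity. Qed.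
Lemma sub_seg t : sub_tm s (@seg G t) = seg. Proof. reflexivity. Qed.
Lemma sub_cat t : sub_tm s (@cat G t) = cat. Proof. reflexivity. Qed.
Lemma sub_code : sub_tm s code = code. Proof. reflexivity. Qed.
Lemma sub_shift : sub_tm s shift = shift. Proof. reflexivity. Qed.
Lemma sub_next : sub_tm s next = next. Proof. reflexivity. Qed.
Lemma sub_dec : sub_tm s dec = dec. Proof. reflexivity. Qed.
Lemma sub_lh : sub_tm s lh = lh. Proof. reflexivity. Qed.
Lemma sub_catf : sub_tm s catf = catf. Proof. reflexivity. Qed.
Lemma sub_zeros : sub_tm s zeros = zeros. Proof. reflexivity. Qed.
Lemma sub_pad : sub_tm s pad = pad. Proof. reflexivity. Qed.
Lemma sub_initS : sub_tm s initS = initS. Proof. reflexivity. Qed.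
Lemma sub_initF : sub_tm s initF = initF. Proof. reflexivity. Qed.
Lemma sub_Hrec : sub_tm s Hrec = Hrec. Proof. reflexivity. Qed.
Lemma sub_Hfun : sub_tm s Hfun = Hfun. Proof. reflexivity. Qed.
End Closed.

Hint Rewrite @ren_as_sub @sub_sub_var @sub_tm_var @sub_add @sub_prd @sub_monus @sub_len
  @sub_snoc @sub_take @sub_seg @sub_cat @sub_code @sub_shift @sub_next @sub_dec
  @sub_lh @sub_catf @sub_zeros @sub_pad @sub_initS @sub_initF @sub_Hrec @sub_Hfun : subst.

Ltac sb :=
  unfold inst_tm, inst, inst2, lift, fLam, fAllst, fAll, wk, ext_refl, ext_cons;
  repeat progress (cbn [sub_tm ren_tm sub_fm ren_fm scons var_case up_sub up_ren map];
                   autorewrite with subst).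
Tactic Notation "sb" "in" hyp(H) :=
  unfold inst_tm, inst, inst2, lift, fLam, fAllst, fAll, wk, ext_refl, ext_cons in H;
  repeat progress (cbn [sub_tm ren_tm sub_fm ren_fm scons var_case up_sub up_ren map] in H;
                   autorewrite with subst in H).

Ltac calc :=
  repeat (rewrite ?beta, ?rec_zero, ?rec_succ, ?lrec_nil, ?lrec_cons; sb);
  try reflexivity.

(** * Computation rules of the arithmetic and sequence terms *)

Section Equations.
Context {G : ctx} (hs : list (fm G)).

Lemma add_zero m : eqv hs (add ∙ m ∙ 0) m.
Proof. unfold add. calc. Qed.
Lemma add_succ m n : eqv hs (add ∙ m ∙ (Succ ∙ n)) (Succ ∙ (add ∙ m ∙ n)).
Proof. unfold add. calc. Qed.
Lemma prd_zero : eqv hs (prd ∙ 0) 0.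
Proof. unfold prd. calc. Qed.
Lemma prd_succ n : eqv hs (prd ∙ (Succ ∙ n)) n.
Proof. unfold prd. calc. Qed.
Lemma monus_zero m : eqv hs (monus ∙ m ∙ 0) m.
Proof. unfold monus. calc. Qed.
Lemma monus_succ m n : eqv hs (monus ∙ m ∙ (Succ ∙ n)) (prd ∙ (monus ∙ m ∙ n)).
Proof. unfold monus. calc. Qed.
Lemma len_nil t : eqv hs (len ∙ @Nil G t) 0.
Proof. unfold len. calc. Qed.
Lemma len_cons t (a : tm G t) l : eqv hs (len ∙ (Cons ∙ a ∙ l)) (Succ ∙ (len ∙ l)).
Proof. unfold len. calc. Qed.
Lemma snoc_nil t (b : tm G t) : eqv hs (snoc ∙ Nil ∙ b) (Cons ∙ b ∙ Nil).
Proof. unfold snoc. calc. Qed.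
Lemma snoc_cons t (a b : tm G t) l :
  eqv hs (snoc ∙ (Cons ∙ a ∙ l) ∙ b) (Cons ∙ a ∙ (snoc ∙ l ∙ b)).
Proof. unfold snoc. calc. Qed.
Lemma take_nil t n : eqv hs (take ∙ @Nil G t ∙ n) Nil.
Proof. unfold take. calc. Qed.
Lemma take_cons_zero t (a : tm G t) l : eqv hs (take ∙ (Cons ∙ a ∙ l) ∙ 0) Nil.
Proof. unfold take. calc. Qed.
Lemma take_cons_succ t (a : tm G t) l n :
  eqv hs (take ∙ (Cons ∙ a ∙ l) ∙ (Succ ∙ n)) (Cons ∙ a ∙ (take ∙ l ∙ n)).
Proof. unfold take. calc. Qed.
Lemma seg_zero t (f : tm G (0 ⇒ t)) : eqv hs (seg ∙ 0 ∙ f) Nil.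
Proof. unfold seg. calc. Qed.
Lemma seg_succ t n (f : tm G (0 ⇒ t)) :
  eqv hs (seg ∙ (Succ ∙ n) ∙ f)
    (Cons ∙ (f ∙ 0) ∙ (seg ∙ n ∙ (λ k : 0, ⇑f ∙ (Succ ∙ k)))).
Proof. unfold seg. calc. Qed.
Lemma cat_cons_zero t (a : tm G t) l f : eqv hs (cat ∙ (Cons ∙ a ∙ l) ∙ f ∙ 0) a.
Proof. unfold cat. calc. Qed.
Lemma cat_cons_succ t (a : tm G t) l f n :
  eqv hs (cat ∙ (Cons ∙ a ∙ l) ∙ f ∙ (Succ ∙ n)) (cat ∙ l ∙ f ∙ n).
Proof. unfold cat. calc. Qed.
Lemma shift_nil : eqv hs (shift ∙ Nil) Nil.
Proof. unfold shift. calc. Qed.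
Lemma shift_cons a l : eqv hs (shift ∙ (Cons ∙ a ∙ l)) (Cons ∙ (Succ ∙ a) ∙ l).
Proof. unfold shift. calc. Qed.
Lemma next_nil : eqv hs (next ∙ Nil) (Cons ∙ 0 ∙ Nil).
Proof. unfold next. calc. Qed.
Lemma next_cons_zero l : eqv hs (next ∙ (Cons ∙ 0 ∙ l)) (shift ∙ (next ∙ l)).
Proof. unfold next. calc. Qed.
Lemma next_cons_succ a l :
  eqv hs (next ∙ (Cons ∙ (Succ ∙ a) ∙ l)) (Cons ∙ 0 ∙ (Cons ∙ a ∙ l)).
Proof. unfold next. calc. Qed.
Lemma dec_zero : eqv hs (dec ∙ 0) Nil.
Proof. unfold dec. calc. Qed.
Lemma dec_succ n : eqv hs (dec ∙ (Succ ∙ n)) (next ∙ (dec ∙ n)).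
Proof. unfold dec. calc. Qed.
Lemma code_nil : eqv hs (code ∙ Nil) 0.
Proof. unfold code. calc. Qed.
Lemma code_cons a l :
  eqv hs (code ∙ (Cons ∙ a ∙ l))
    (Rec ∙ (Succ ∙ (add ∙ (code ∙ l) ∙ (code ∙ l)))
         ∙ (λ k : 0, λ q : 0, add ∙ q ∙ q) ∙ a).
Proof. unfold code. calc. Qed.
Lemma lh_dec s : eqv hs (lh ∙ s) (len ∙ (dec ∙ s)).
Proof. unfold lh. calc. Qed.
Lemma pad_cat s : eqv hs (pad ∙ s) (cat ∙ (dec ∙ s) ∙ zeros).
Proof. unfold pad, catf. calc. Qed.
Lemma initS_take s M : eqv hs (initS ∙ s ∙ M) (code ∙ (take ∙ (dec ∙ s) ∙ M)).
Proof. unfold initS. calc. Qed.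
Lemma initF_seg f M : eqv hs (initF ∙ f ∙ M) (code ∙ (seg ∙ M ∙ f)).
Proof. unfold initF. calc. Qed.
Lemma Hrec_zero Y M s : eqv hs (Hrec ∙ Y ∙ M ∙ 0 ∙ s) (Y ∙ (pad ∙ (initS ∙ s ∙ M))).
Proof. unfold Hrec. calc. Qed.
Lemma Hfun_Hrec Y s M :
  eqv hs (Hfun ∙ Y ∙ s ∙ M) (Hrec ∙ Y ∙ M ∙ (monus ∙ M ∙ (lh ∙ s)) ∙ s).
Proof. unfold Hfun. calc. Qed.
End Equations.

(** * Derived rules of natural deduction *)

Lemma prv_bot {G hs} {p : fm G} : prv G hs Bot -> prv G hs p.
Proof.
  intro H. apply (prv_impE _ _ Bot); [|exact H].
  apply prv_impI, prv_raa, prv_hyp. right. left. reflexivity.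
Qed.

Lemma prv_weaken {G hs p} : prv G hs p -> forall ks, incl hs ks -> prv G ks p.
Proof.
  induction 1; intros ks Hk.
  - now apply prv_ax.
  - apply prv_hyp; auto.
  - apply prv_impI, IHprv. intros x [<-|Hx]; [left; reflexivity|right; auto].
  - eapply prv_impE; eauto.
  - apply prv_raa, IHprv. intros x [<-|Hx]; [left; reflexivity|right; auto].
  - apply prv_allI, IHprv. now apply incl_map.
  - apply prv_allE; auto.
Qed.

Lemma prv_weaken1 {G hs p} (q : fm G) : prv G hs p -> prv G (q :: hs) p.
Proof. intro H. apply (prv_weaken H), incl_tl, incl_refl. Qed.

Lemma prv_hyp0 {G hs} {p : fm G} : prv G (p :: hs) p.
Proof. apply prv_hyp. left. reflexivity. Qed.

Lemma prv_andI {G hs} {p q : fm G} : prv G hs p -> prv G hs q -> prv G hs (p ∧ q).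
Proof.
  intros Hp Hq. apply prv_impI.
  refine (prv_impE _ _ _ _ (prv_impE _ _ _ _ prv_hyp0 _) _); now apply prv_weaken1.
Qed.

Lemma prv_andEr {G hs} {p q : fm G} : prv G hs (p ∧ q) -> prv G hs q.
Proof.
  intro H. apply prv_raa. refine (prv_impE _ _ _ _ (prv_weaken1 _ H) _).
  apply prv_impI, prv_weaken1, prv_hyp0.
Qed.

Lemma prv_cases {G hs} (p : fm G) {q} :
  prv G (p :: hs) q -> prv G ((¬ p) :: hs) q -> prv G hs q.
Proof.
  intros H1 H2. apply prv_raa.
  apply prv_impI in H1, H2.
  refine (prv_impE _ _ _ _ prv_hyp0 (prv_impE _ _ _ _ (prv_weaken1 _ H2) _)).
  apply prv_impI.
  refine (prv_impE _ _ _ _ (prv_weaken1 _ prv_hyp0)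
    (prv_impE _ _ _ _ (prv_weaken1 _ (prv_weaken1 _ H1)) prv_hyp0)).
Qed.

Lemma prv_orE {G hs} {p q r : fm G} :
  prv G hs (p ∨ q) -> prv G (p :: hs) r -> prv G (q :: hs) r -> prv G hs r.
Proof.
  intros H H1 H2. apply (prv_cases p); [exact H1|].
  refine (prv_impE _ _ _ _ (prv_weaken1 _ (prv_impI _ _ _ _ H2)) _).
  exact (prv_impE _ _ _ _ (prv_weaken1 _ H) prv_hyp0).
Qed.

(** Since [fEx] abbreviates ¬∀¬, elimination is a reductio: under [¬ q], the second premise refutes
    [p] at the fresh variable. *)
Lemma prv_exE {G hs t} {p : tm (t :: G) t -> fm (t :: G)} {q : fm G} :
  prv G hs (fEx t p) ->
  prv (t :: G) (p (Var vz) :: map (ren_fm (wk t)) hs) (ren_fm (wk t) q) ->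
  prv G hs q.
Proof.
  intros H H1. apply prv_raa. refine (prv_impE _ _ _ _ (prv_weaken1 _ H) _).
  apply prv_allI, prv_impI. cbn [map].
  apply (prv_impE _ _ (ren_fm (wk t) q)); [apply prv_hyp; right; left; reflexivity|].
  apply (prv_weaken H1). apply incl_cons; [left; reflexivity|].
  apply incl_tl, incl_tl, incl_refl.
Qed.

Lemma prv_nat_ind {G hs} (p : fm (Nat :: G)) : internal p ->
  prv G hs (inst p 0%tm) ->
  prv (Nat :: G) (p :: map (ren_fm (wk 0%ty)) hs)
    (inst (e := ext_cons _ _ _ (ext_refl _)) p (Succ ∙ Var vz)) ->
  prv G hs (All p).
Proof.
  intros Hp H0 HS.
  pose proof (prv_ax G hs _ (ax_EPA _ (ax_induction p Hp))) as H.
  unfold fAll in H. rewrite inst_self in H.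
  refine (prv_impE _ _ _ _ (prv_impE _ _ _ _ H H0) _).
  apply prv_allI, prv_impI, HS.
Qed.

(** [ax_seq] gives a case distinction on sequences; the inductions below all run over numbers. *)
Lemma prv_list_case {G hs t} (l : tm G (t^*)) {q : fm G} :
  prv G ((l == Nil) :: hs) q ->
  prv (Seq t :: t :: G)
    ((⇑l == Cons ∙ Var (vs vz) ∙ Var vz) :: map (ren_fm (wk _)) (map (ren_fm (wk _)) hs))
    (ren_fm (wk _) (ren_fm (wk _) q)) ->
  prv G hs q.
Proof.
  intros H0 HS.
  refine (prv_orE (prv_ax _ _ _ (ax_EPA _ (ax_seq _ l))) H0 _).
  refine (prv_exE prv_hyp0 _). refine (prv_exE prv_hyp0 _).
  apply (prv_weaken HS). apply incl_cons; [left; reflexivity|].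
  cbn [map]. apply incl_tl, incl_tl, incl_tl, incl_refl.
Qed.

Lemma eqv_ext {G hs t u} (f g : tm G (t ⇒ u)) :
  eqv (map (ren_fm (wk t)) hs) (ren_tm (wk t) f ∙ Var vz) (ren_tm (wk t) g ∙ Var vz) ->
  eqv hs f g.
Proof.
  intro H. refine (prv_impE _ _ _ _ (prv_ax _ _ _ (ax_EPA _ (ax_extensionality _ _ f g))) _).
  apply prv_allI, H.
Qed.

Ltac to_eqv :=
  match goal with |- prv _ ?hs (Eq ?a ?b) => change (eqv hs a b) end.
Tactic Notation "to_eqv" "in" hyp(H) :=
  match type of H with prv _ ?hs (Eq ?a ?b) => change (eqv hs a b) in H end.
(** The newest hypothesis becomes a Rocq assumption and the list an opaque variable, so that
    rewriting touches the conclusion only. *)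
Ltac head_hyp IH :=
  match goal with |- prv _ (?p :: ?hs) _ =>
    pose proof (prv_hyp0 : prv _ (p :: hs) p) as IH;
    generalize dependent (p :: hs); intros ks IH; try to_eqv in IH
  end.
Ltac spec H a := apply (prv_allE _ _ _ _ a) in H; sb in H; try to_eqv in H.

(** * Addition and truncated subtraction *)

Lemma succ_add {G} (hs : list (fm G)) m n :
  eqv hs (add ∙ (Succ ∙ m) ∙ n) (Succ ∙ (add ∙ m ∙ n)).
Proof.
  assert (H : prv G hs (∀ n : 0, add ∙ (Succ ∙ ⇑m) ∙ n == Succ ∙ (add ∙ ⇑m ∙ n))).
  { apply prv_nat_ind; [exact I|sb|sb; head_hyp IH]; to_eqv.
    - now rewrite !add_zero.
    - now rewrite !add_succ, IH. }
  spec H n. exact H.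
Qed.

Lemma zero_add {G} (hs : list (fm G)) n : eqv hs (add ∙ 0 ∙ n) n.
Proof.
  assert (H : prv G hs (∀ n : 0, add ∙ 0 ∙ n == n)).
  { apply prv_nat_ind; [exact I|sb|sb; head_hyp IH]; to_eqv.
    - apply add_zero.
    - now rewrite add_succ, IH. }
  spec H n. exact H.
Qed.

Lemma add_comm {G} (hs : list (fm G)) m n : eqv hs (add ∙ m ∙ n) (add ∙ n ∙ m).
Proof.
  assert (H : prv G hs (∀ n : 0, add ∙ ⇑m ∙ n == add ∙ n ∙ ⇑m)).
  { apply prv_nat_ind; [exact I|sb|sb; head_hyp IH]; to_eqv.
    - now rewrite add_zero, zero_add.
    - now rewrite add_succ, succ_add, IH. }
  spec H n. exact H.
Qed.

Lemma zero_monus {G} (hs : list (fm G)) n : eqv hs (monus ∙ 0 ∙ n) 0.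
Proof.
  assert (H : prv G hs (∀ n : 0, monus ∙ 0 ∙ n == 0)).
  { apply prv_nat_ind; [exact I|sb|sb; head_hyp IH]; to_eqv.
    - apply monus_zero.
    - now rewrite monus_succ, IH, prd_zero. }
  spec H n. exact H.
Qed.

Lemma succ_monus_succ {G} (hs : list (fm G)) m n :
  eqv hs (monus ∙ (Succ ∙ m) ∙ (Succ ∙ n)) (monus ∙ m ∙ n).
Proof.
  assert (H : prv G hs (∀ n : 0,
    monus ∙ (Succ ∙ ⇑m) ∙ (Succ ∙ n) == monus ∙ ⇑m ∙ n)).
  { apply prv_nat_ind; [exact I|sb|sb; head_hyp IH]; to_eqv.
    - now rewrite monus_succ, !monus_zero, prd_succ.
    - now rewrite monus_succ, IH, <- monus_succ. }
  spec H n. exact H.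
Qed.

(** This zero is the recursion depth that [Hfun] computes for a sequence of length [n + m]: it
    selects the base clause of [H]. *)
Lemma monus_add {G} (hs : list (fm G)) n m : eqv hs (monus ∙ m ∙ (add ∙ n ∙ m)) 0.
Proof.
  assert (H : prv G hs (∀ m : 0, monus ∙ m ∙ (add ∙ ⇑n ∙ m) == 0)).
  { apply prv_nat_ind; [exact I|sb|sb; head_hyp IH]; to_eqv.
    - apply zero_monus.
    - now rewrite add_succ, succ_monus_succ. }
  spec H m. exact H.
Qed.

Lemma zero_or_succ {G} (hs : list (fm G)) m : prv G hs (m == 0 ∨ m == Succ ∙ (prd ∙ m)).
Proof.
  assert (H : prv G hs (∀ m : 0, m == 0 ∨ m == Succ ∙ (prd ∙ m))).
  { apply prv_nat_ind; [cbn; tauto| |]; unfold Or; sb; apply prv_impI.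
    - apply prv_bot. refine (prv_impE _ _ _ _ prv_hyp0 _). to_eqv. reflexivity.
    - to_eqv. now rewrite prd_succ. }
  spec H m. exact H.
Qed.

(** * Decoding of sequence codes *)

(** On codes, [shift] is doubling, [next] adds 1, and prefixing 0 sends c to 2c + 1. *)
Lemma next_shift {G} (hs : list (fm G)) l : eqv hs (next ∙ (shift ∙ l)) (Cons ∙ 0 ∙ l).
Proof.
  apply (prv_list_case l); sb; head_hyp E; to_eqv; rewrite E.
  - now rewrite shift_nil, next_nil.
  - now rewrite shift_cons, next_cons_succ.
Qed.

Lemma take_zero {G} (hs : list (fm G)) t (l : tm G (t^*)) : eqv hs (take ∙ l ∙ 0) Nil.
Proof.
  apply (prv_list_case l); sb; head_hyp E; to_eqv; rewrite E.
  - apply take_nil.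
  - apply take_cons_zero.
Qed.

(** Raising [n] by 1 applies [next] twice on the left: the first turns [shift] into a prefixed 0,
    the second turns that into [shift] of [next]. *)
Lemma dec_double {G} (hs : list (fm G)) n :
  eqv hs (dec ∙ (add ∙ n ∙ n)) (shift ∙ (dec ∙ n)).
Proof.
  assert (H : prv G hs (∀ n : 0, dec ∙ (add ∙ n ∙ n) == shift ∙ (dec ∙ n))).
  { apply prv_nat_ind; [exact I|sb|sb; head_hyp IH]; to_eqv.
    - now rewrite add_zero, dec_zero, shift_nil.
    - now rewrite add_succ, succ_add, !dec_succ, IH, next_shift, next_cons_zero. }
  spec H n. exact H.
Qed.

(** Induction on the head [a]: raising it by 1 doubles the code, which by [dec_double] shifts the
    decoded sequence. *)
Lemma dec_code_cons {G} (hs : list (fm G)) a l :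
  eqv hs (dec ∙ (code ∙ (Cons ∙ a ∙ l))) (Cons ∙ a ∙ (dec ∙ (code ∙ l))).
Proof.
  assert (H : prv G hs (∀ a : 0,
    dec ∙ (code ∙ (Cons ∙ a ∙ ⇑l)) == Cons ∙ a ∙ (dec ∙ (code ∙ ⇑l)))).
  { apply prv_nat_ind; [exact I|sb|sb; head_hyp IH]; to_eqv.
    - now rewrite code_cons, rec_zero, dec_succ, dec_double, next_shift.
    - rewrite code_cons, rec_succ. sb. rewrite !beta. sb. rewrite !beta. sb.
      rewrite dec_double. rewrite code_cons in IH. sb in IH. now rewrite IH, shift_cons. }
  spec H a. exact H.
Qed.

(** * Initial segments *)

(** [seg_succ] replaces [f] by its tail. The inductions on the length therefore quantify over [f],
    and the hypothesis is used at that tail. *)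
Ltac spec_tail IH :=
  match goal with |- context [App (App seg _) (Lam ?b)] => spec IH (Lam b) end.

Lemma len_seg {G} (hs : list (fm G)) t n (f : tm G (0 ⇒ t)) :
  eqv hs (len ∙ (seg ∙ n ∙ f)) n.
Proof.
  assert (H : prv G hs (∀ n : 0, ∀ f : 0 ⇒ t, len ∙ (seg ∙ ⇑n ∙ f) == ⇑n)).
  { apply prv_nat_ind; [exact I| |]; sb; apply prv_allI; sb; [|head_hyp IH]; to_eqv.
    - now rewrite seg_zero, len_nil.
    - rewrite seg_succ, len_cons. sb. spec_tail IH. now rewrite IH. }
  spec H n. spec H f. exact H.
Qed.

Lemma dec_code_seg {G} (hs : list (fm G)) n f :
  eqv hs (dec ∙ (code ∙ (seg ∙ n ∙ f))) (seg ∙ n ∙ f).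
Proof.
  assert (H : prv G hs (∀ n : 0, ∀ f : 0 ⇒ 0,
    dec ∙ (code ∙ (seg ∙ ⇑n ∙ f)) == seg ∙ ⇑n ∙ f)).
  { apply prv_nat_ind; [exact I| |]; sb; apply prv_allI; sb; [|head_hyp IH]; to_eqv.
    - now rewrite seg_zero, code_nil, dec_zero.
    - rewrite seg_succ, dec_code_cons. sb. spec_tail IH. now rewrite IH. }
  spec H n. spec H f. exact H.
Qed.

(** [seg] recurses at the front; the back view serves the step from [n] to [n + 1] when two
    functions are compared value by value. *)
Lemma seg_succ_snoc {G} (hs : list (fm G)) t n (f : tm G (0 ⇒ t)) :
  eqv hs (seg ∙ (Succ ∙ n) ∙ f) (snoc ∙ (seg ∙ n ∙ f) ∙ (f ∙ n)).
Proof.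
  assert (H : prv G hs (∀ n : 0, ∀ f : 0 ⇒ t,
    seg ∙ (Succ ∙ ⇑n) ∙ f == snoc ∙ (seg ∙ ⇑n ∙ f) ∙ (f ∙ ⇑n))).
  { apply prv_nat_ind; [exact I| |]; sb; apply prv_allI; sb; [|head_hyp IH]; to_eqv.
    - now rewrite seg_succ, !seg_zero, snoc_nil.
    - rewrite seg_succ. sb. spec_tail IH. rewrite IH, seg_succ, snoc_cons, beta. sb.
      reflexivity. }
  spec H n. spec H f. exact H.
Qed.

(** The length [add ∙ n ∙ m] says [at least m] without an order relation, and [add] recurses on its
    second argument, which suits induction on [m]. *)
Lemma take_seg {G} (hs : list (fm G)) t n m (f : tm G (0 ⇒ t)) :
  eqv hs (take ∙ (seg ∙ (add ∙ n ∙ m) ∙ f) ∙ m) (seg ∙ m ∙ f).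
Proof.
  assert (H : prv G hs (∀ m : 0, ∀ f : 0 ⇒ t,
    take ∙ (seg ∙ (add ∙ ⇑n ∙ ⇑m) ∙ f) ∙ ⇑m == seg ∙ ⇑m ∙ f)).
  { apply prv_nat_ind; [exact I| |]; sb; apply prv_allI; sb; [|head_hyp IH]; to_eqv.
    - now rewrite seg_zero, take_zero.
    - rewrite add_succ, !seg_succ, take_cons_succ. sb. spec_tail IH. now rewrite IH. }
  spec H m. spec H f. exact H.
Qed.

(** The left side has the shape that [seg_succ] produces; being an equation of functions, it needs
    extensionality. *)
Lemma tail_cat_cons {G} (hs : list (fm G)) t (a : tm G t) l z :
  eqv hs (λ k : 0, ⇑(cat ∙ (Cons ∙ a ∙ l) ∙ z) ∙ (Succ ∙ k)) (cat ∙ l ∙ z).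
Proof. apply eqv_ext. sb. rewrite beta. sb. apply cat_cons_succ. Qed.

Lemma seg_cat_seg {G} (hs : list (fm G)) t n m (f z : tm G (0 ⇒ t)) :
  eqv hs (seg ∙ m ∙ (cat ∙ (seg ∙ (add ∙ n ∙ m) ∙ f) ∙ z)) (seg ∙ m ∙ f).
Proof.
  assert (H : prv G hs (∀ m : 0, ∀ f : 0 ⇒ t,
    seg ∙ ⇑m ∙ (cat ∙ (seg ∙ (add ∙ ⇑n ∙ ⇑m) ∙ f) ∙ ⇑z) == seg ∙ ⇑m ∙ f)).
  { apply prv_nat_ind; [exact I| |]; sb; apply prv_allI; sb; [|head_hyp IH]; to_eqv.
    - now rewrite !seg_zero.
    - rewrite add_succ, (seg_succ _ _ (add ∙ _ ∙ _)%tm), !(seg_succ _ _ (Var _)).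
      rewrite cat_cons_zero, tail_cat_cons. sb.
      spec_tail IH. now rewrite IH. }
  spec H m. spec H f. exact H.
Qed.

(** * Standard and nonstandard numbers *)

Lemma St_eqv {G hs t} {a b : tm G t} : eqv hs a b -> prv G hs (St a) -> prv G hs (St b).
Proof.
  intros E H. exact (prv_impE _ _ _ _ (prv_ax _ _ _ (ax_st_eq _ a b)) (prv_andI H E)).
Qed.

Lemma St_zero {G} (hs : list (fm G)) : prv G hs (St 0%tm).
Proof. exact (prv_ax _ _ _ (ax_st_closed _ Zero)). Qed.

Lemma St_succ {G hs} {n : tm G 0} : prv G hs (St n) -> prv G hs (St (Succ ∙ n)%tm).
Proof.
  intro H. refine (prv_impE _ _ _ _ (prv_ax _ _ _ (ax_st_app _ _ _ _)) (prv_andI _ H)).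
  exact (prv_ax _ _ _ (ax_st_closed _ Succ)).
Qed.

Ltac get_hyp i H :=
  match goal with |- prv ?G ?hs _ =>
    let p := eval cbv [nth] in (nth i hs Bot) in
    assert (H : prv G hs p) by (apply prv_hyp; cbn [In]; repeat first [left; reflexivity | right]);
    try to_eqv in H
  end.

(* Setoid rewriting would otherwise look for redexes inside the hypotheses. *)
Ltac abstract_hyps :=
  match goal with |- prv _ ?hs _ =>
    let ks := fresh "ks" in set (ks := hs) in *; clearbody ks
  end.

(** External induction on [x], as the formula contains [St]. A nonzero [m] is the successor of
    [prd ∙ m], to which the hypothesis for the predecessor of [x] applies. The order is expressed by
    [k + m = x]. *)
Lemma St_of_add {G} (hs : list (fm G)) :
  prv G hs (∀st x : 0, ∀ k : 0, ∀ m : 0, add ∙ ⇑k ∙ m == ⇑x → St m).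
Proof.
  pose proof (prv_ax G hs _ (ax_external_induction
    (∀ k : 0, ∀ m : 0, add ∙ ⇑k ∙ m == Var (vs (vs vz)) → St m))) as H.
  sb in H. sb. refine (prv_impE _ _ _ _ (prv_impE _ _ _ _ H _) _); clear H.
  - apply prv_allI, prv_allI, prv_impI.
    refine (prv_orE (zero_or_succ _ (Var vz)) _ _); get_hyp 0 E; get_hyp 1 H.
    + exact (St_eqv (symmetry E) (St_zero _)).
    (* For [x = 0] and [m] a successor, the sum would be a successor equal to 0. *)
    + abstract_hyps. apply prv_bot.
      refine (prv_impE _ _ _ _ (prv_ax _ _ _ (ax_EPA _
        (ax_succ_nonzero (add ∙ Var (vs vz) ∙ (prd ∙ Var vz))%tm))) _).
      to_eqv. rewrite <- add_succ, <- E. exact H.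
  - apply prv_allI, prv_impI, prv_impI, prv_allI, prv_allI, prv_impI. sb.
    refine (prv_orE (zero_or_succ _ (Var vz)) _ _); get_hyp 0 E; get_hyp 1 H; get_hyp 2 IH.
    + exact (St_eqv (symmetry E) (St_zero _)).
    + abstract_hyps. apply (St_eqv (symmetry E)), St_succ.
      spec IH (Var (vs vz) : tm (Nat :: Nat :: Nat :: G) 0).
      spec IH (prd ∙ Var vz : tm (Nat :: Nat :: Nat :: G) 0)%tm.
      refine (prv_impE _ _ _ _ IH _).
      refine (prv_impE _ _ _ _ (prv_ax _ _ _ (ax_EPA _ (ax_succ_inj _ _))) _). to_eqv.
      rewrite <- add_succ, <- E. exact H.
Qed.

(** If the sum were standard, [St_of_add] would make [m] standard. This admits [N + M] as a second
    nonstandard argument of [H]. *)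
Lemma Omega_add {G} (hs : list (fm G)) n m :
  prv G hs (Omega m) -> prv G hs (Omega (add ∙ n ∙ m)%tm).
Proof.
  intro Hm. apply prv_impI. refine (prv_impE _ _ _ _ (prv_weaken1 _ Hm) _).
  pose proof (St_of_add hs) as H. spec H (add ∙ n ∙ m)%tm.
  pose proof (prv_impE _ _ _ _ (prv_weaken1 _ H) prv_hyp0) as K.
  spec K n. spec K m. refine (prv_impE _ _ _ _ K _). to_eqv. reflexivity.
Qed.

(** * Values of [H] and [Y] at long initial segments *)

Lemma seg_pad_seg {G} (hs : list (fm G)) n m f :
  eqv hs (seg ∙ m ∙ (pad ∙ (code ∙ (seg ∙ (add ∙ n ∙ m) ∙ f)))) (seg ∙ m ∙ f).
Proof. now rewrite pad_cat, dec_code_seg, seg_cat_seg. Qed.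

(** The sequence has length at least [m], so the recursion has depth 0 and [initS] cuts the sequence
    back to length [m]. *)
Lemma Hfun_seg {G} (hs : list (fm G)) Y n m f :
  eqv hs (Hfun ∙ Y ∙ (code ∙ (seg ∙ (add ∙ n ∙ m) ∙ f)) ∙ m)
    (Y ∙ (pad ∙ (code ∙ (seg ∙ m ∙ f)))).
Proof.
  now rewrite Hfun_Hrec, lh_dec, dec_code_seg, len_seg, monus_add, Hrec_zero,
    initS_take, dec_code_seg, take_seg.
Qed.

Lemma Hfun_seg_self {G} (hs : list (fm G)) Y m f :
  eqv hs (Hfun ∙ Y ∙ (code ∙ (seg ∙ m ∙ f)) ∙ m) (Y ∙ (pad ∙ (code ∙ (seg ∙ m ∙ f)))).
Proof. rewrite <- (Hfun_seg hs Y Zero m f). now rewrite zero_add. Qed.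

(** The value on the right does not mention [h], so two choices of [h] give [Y] the same value. *)
Lemma pad_seg_value {G} (hs : list (fm G)) (Gam : tm G (2 ⇒ 0 ⇒ 0)) Y f h M N
  (HGam : forall K L s, prv G hs (Omega K) -> prv G hs (Omega L) ->
     eqv hs (initF ∙ f ∙ L) (initF ∙ (pad ∙ s) ∙ L) ->
     eqv hs (Gam ∙ Y ∙ s) (Hfun ∙ Y ∙ s ∙ K))
  (HN : forall g, eqv hs (initF ∙ g ∙ N) (initF ∙ h ∙ N) -> eqv hs (Y ∙ h) (Y ∙ g))
  (HM : prv G hs (Omega M)) (Hadd : prv G hs (Omega (add ∙ N ∙ M)%tm))
  (Hfh : eqv hs (seg ∙ M ∙ f) (seg ∙ M ∙ h)) :
  eqv hs (Y ∙ h) (Y ∙ (pad ∙ (code ∙ (seg ∙ M ∙ f)))).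
Proof.
  assert (E : eqv hs (initF ∙ f ∙ M)
    (initF ∙ (pad ∙ (code ∙ (seg ∙ (add ∙ N ∙ M) ∙ h))) ∙ M)).
  { now rewrite !initF_seg, Hfh, seg_pad_seg. }
  pose proof (HGam _ _ _ Hadd HM E) as E1.
  pose proof (HGam _ _ _ HM HM E) as E2.
  (* With [s] the code of the first [N + M] values of [h], the right side becomes in turn
     [H(Y,s,M)], [Gam(Y,s)], [H(Y,s,N+M)] and [Y(s * 00...)]. *)
  rewrite Hfh, <- (Hfun_seg hs Y N M h), <- E2, E1, Hfun_seg_self.
  (* Commuting the sum puts [N] last, so that [seg_pad_seg] compares the first [N] values. *)
  apply HN. now rewrite !initF_seg, add_comm, seg_pad_seg.
Qed.

(* The second clause of GHS at given [Y] and [alpha := f]. *)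
Definition stable {G} (Gam : tm G (2 ⇒ 0 ⇒ 0)) (Y : tm G 2) (f : tm G 1) : fm G :=
  ∀ N : 0, ∀ M : 0, Omega ⇑N → Omega M → ∀ s : 0,
    initF ∙ ⇑f ∙ ⇑M == initF ∙ (pad ∙ s) ∙ ⇑M → ⇑Gam ∙ ⇑Y ∙ s == Hfun ∙ ⇑Y ∙ s ∙ ⇑N.

Definition modulus {G} (Y : tm G 2) (f : tm G 1) (N : tm G 0) : fm G :=
  ∀ g : 1, initF ∙ g ∙ ⇑N == initF ∙ ⇑f ∙ ⇑N → ⇑Y ∙ ⇑f == ⇑Y ∙ g.

Lemma stableE {G hs Gam Y} {f : tm G 1} : prv G hs (stable Gam Y f) ->
  forall N M s, prv G hs (Omega N) -> prv G hs (Omega M) ->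
  eqv hs (initF ∙ f ∙ M) (initF ∙ (pad ∙ s) ∙ M) ->
  eqv hs (Gam ∙ Y ∙ s) (Hfun ∙ Y ∙ s ∙ N).
Proof.
  intros H N M s HN HM E. unfold stable, Omega, Not in H.
  spec H N. spec H M. apply prv_impE with (2 := HN), prv_impE with (2 := HM) in H.
  spec H s. exact (prv_impE _ _ _ _ H E).
Qed.

Lemma modulusE {G hs Y} {f : tm G 1} {N} : prv G hs (modulus Y f N) ->
  forall g, eqv hs (initF ∙ g ∙ N) (initF ∙ f ∙ N) -> eqv hs (Y ∙ f) (Y ∙ g).
Proof.
  intros H g E. unfold modulus in H. spec H g. exact (prv_impE _ _ _ _ H E).
Qed.

Lemma inC_modulus {G hs} {Y : tm G 2} (f : tm G 1) :
  prv G hs (inC Y) -> prv G hs (∃ N : 0, modulus ⇑Y ⇑f N).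
Proof.
  intro H. unfold inC, fEx, Not in H. spec H f.
  unfold modulus, fEx, Not. sb. exact H.
Qed.

(** The premises are implications of the object language: the induction step adds a variable to the
    context, and premises in the hypothesis list are renamed along with it. The formula proved by
    induction is internal, although its step splits on [St]. *)
Lemma stable_approx_eq {G} (hs : list (fm G)) Gam Y f g N K :
  prv G hs (stable Gam Y f → modulus Y f N → modulus Y g K → approx1 f g →
    Y ∙ f == Y ∙ g).
Proof.
  do 4 apply prv_impI.
  apply (prv_cases (Y ∙ f == Y ∙ g)); [exact prv_hyp0|].
  assert (H : prv G ((¬ Y ∙ f == Y ∙ g) :: approx1 f g :: modulus Y g K
      :: modulus Y f N :: stable Gam Y f :: hs) (∀ n : 0, seg ∙ n ∙ ⇑f == seg ∙ n ∙ ⇑g)).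
  { apply prv_nat_ind; [exact I| |].
    - sb. to_eqv. now rewrite !seg_zero.
    - unfold stable, modulus, approx1, Omega, Not. sb.
      apply (prv_cases (St (Var vz))); get_hyp 0 Hn; get_hyp 1 IH; get_hyp 2 Hneq;
        get_hyp 3 Happ; get_hyp 4 Hg; get_hyp 5 Hf; get_hyp 6 Hst; abstract_hyps.
      + spec Happ (Var (t := 0) (G := Nat :: G) vz).
        apply prv_impE with (2 := Hn) in Happ. to_eqv in Happ. to_eqv.
        now rewrite !seg_succ_snoc, IH, Happ.
      (* The nonstandard [n] itself serves as [M]: the induction hypothesis is the required
         agreement of [f] and [g] below it. *)
      + apply prv_bot. refine (prv_impE _ _ _ _ Hneq _). to_eqv.
        assert (E : forall h L, prv _ ks (modulus (⇑Y) h L) ->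
          eqv ks (seg ∙ Var vz ∙ ⇑f) (seg ∙ Var vz ∙ h) ->
          eqv ks (⇑Y ∙ h) (⇑Y ∙ (pad ∙ (code ∙ (seg ∙ Var vz ∙ ⇑f))))).
        { intros h L HL Hh. apply (pad_seg_value _ ⇑Gam _ _ _ _ L).
          - apply stableE. unfold stable, Omega, Not. sb. exact Hst.
          - exact (modulusE HL).
          - exact Hn.
          - apply Omega_add, Hn.
          - exact Hh. }
        specialize (E (⇑f) (⇑N)) as E1. specialize (E (⇑g) (⇑K)) as E2.
        unfold modulus in E1, E2. sb in E1. sb in E2.
        rewrite E1, E2; [reflexivity|assumption..|reflexivity]. }
  (* Agreement at all lengths includes the modulus [N] of [Y] at [f]. *)
  apply (modulusE (N := N)); [get_hyp 3 Hf; exact Hf|].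
  spec H N. rewrite !initF_seg, H. reflexivity.
Qed.

Theorem theorem4p15 : provable_in_P (Imp GHS NPC).
Proof.
  (* The variables, newest first: moduli at [g] and [f], then [g], [f], [Y], [Gam]. *)
  apply prv_impI. refine (prv_exE prv_hyp0 _).
  apply prv_allI, prv_impI, prv_impI, prv_allI, prv_impI, prv_allI, prv_impI.
  refine (prv_exE (inC_modulus (Y := Var (vs (vs vz))) (Var (vs vz)) _) _).
  { apply prv_hyp. do 2 right. left. reflexivity. }
  refine (prv_exE (inC_modulus (Y := Var (vs (vs (vs vz)))) (Var (vs vz)) _) _).
  { apply prv_hyp. do 3 right. left. reflexivity. }
  apply (prv_impE _ _ (approx1 (Var (vs (vs (vs vz)))) (Var (vs (vs vz))))).
  2: { apply prv_hyp. do 2 right. left. reflexivity. }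
  apply (prv_impE _ _ (modulus (Var (vs (vs (vs (vs vz))))) (Var (vs (vs vz))) (Var vz))).
  2: { apply prv_hyp. left. reflexivity. }
  apply (prv_impE _ _ (modulus (Var (vs (vs (vs (vs vz))))) (Var (vs (vs (vs vz)))) (Var (vs vz)))).
  2: { apply prv_hyp. right. left. reflexivity. }
  refine (prv_impE _ _ _ _ (stable_approx_eq _ (Var (vs (vs (vs (vs (vs vz)))))) _ _ _ _ _) _).
  match goal with |- prv ?G ?hs ?p =>
    assert (HG : prv G hs (∀st Y : 2, inC Y → ∀st f : 1,
      stable (⇑(Var (vs (vs (vs (vs (vs vz))))))) ⇑Y f)) end.
  (* The first projection drops [St Gam], the second [GHst Gam]; what remains is the comparison of
     [Gam] with [H]. *)
  { refine (prv_andEr (prv_andEr (prv_hyp _ _ _ _))). do 6 right. left. reflexivity. }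
  apply (prv_allE _ _ _ _ (Var (vs (vs (vs (vs vz)))))) in HG.
  refine (prv_impE _ _ (St (Var (vs (vs (vs vz))))) _
    (prv_allE _ _ _ _ (Var (vs (vs (vs vz))))
      (prv_impE _ _ _ _ (prv_impE _ _ _ _ HG _) _)) _); apply prv_hyp.
  - do 5 right. left. reflexivity.
  - do 4 right. left. reflexivity.
  - do 3 right. left. reflexivity.
Qed.
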